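(* Let $p$ be a prime, let $m>0$ and $n\geq 2$ be integers, let $q=p^m$, let $\mathcal{F}$ be a field with $q$ elements, and let $\mathcal{G}=\mathrm{GL}(n,q)$ be the group of invertible $n\times n$ matrices over $\mathcal{F}$. Let $A$ and $B$ be matrices in $\mathcal{G}$. Then one of the following holds: (i) $A^{\mathcal{G}}B^{\mathcal{G}}=(AB)^{\mathcal{G}}$ and at least one of $A$, $B$ is a scalar matrix. (ii) $A^{\mathcal{G}}B^{\mathcal{G}}$ is the union of at least $q-1$ distinct conjugacy classes of $\mathcal{G}$, i.e. $\eta(A^{\mathcal{G}}B^{\mathcal{G}})\geq q-1$.
   Context: For a finite group $\mathcal{G}$ and $A\in\mathcal{G}$, $A^{\mathcal{G}}=\{A^B\mid B\in\mathcal{G}\}$ denotes the conjugacy class of $A$ in $\mathcal{G}$, where $A^B=B^{-1}AB$. For $A,B\in\mathcal{G}$, $A^{\mathcal{G}}B^{\mathcal{G}}=\{XY\mid X\in A^{\mathcal{G}},\,Y\in B^{\mathcal{G}}\}$; this set is invariant under conjugation by $\mathcal{G}$, hence is a union of conjugacy classes of $\mathcal{G}$. For a nonempty conjugation-invariant subset $\mathcal{X}\subseteq\mathcal{G}$, $\eta(\mathcal{X})$ denotes the number of distinct conjugacy classes of $\mathcal{G}$ whose union is $\mathcal{X}$. *)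

(* Defs.v *)
From HB Require Import structures.
From mathcomp Require Export all_boot all_order all_fingroup all_algebra.

Set Implicit Arguments.
Unset Strict Implicit.
Unset Printing Implicit Defensive.

Local Open Scope group_scope.

(* Meant for X invariant under conjugation by G: the G-classes contained in X
   are then exactly those whose union is X (eta_classes, cover_etaM). *)
Definition eta (gT : finGroupType) (G : {group gT}) (X : {set gT}) : nat :=
  #|[set C in classes G | C \subset X]|.

Arguments eta {gT} G%_G X%_g.

Lemma eta_classes (gT : finGroupType) (G : {group gT}) (X : {set gT})
    (P : {set {set gT}}) :
  P \subset classes G -> cover P = X -> eta G X = #|P|.
Proof.
move=> sPG defX; rewrite /eta; congr #|pred_of_set _|.
apply/setP=> C; rewrite inE; apply/andP/idP=> [[GC sCX] | PC]; last first.
  by rewrite (subsetP sPG) // -defX (bigcup_max C).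
have /imsetP[x Gx defC] := GC.
have: x \in X by rewrite (subsetP sCX) // defC class_refl.
rewrite -defX => /bigcupP[D PD Dx].
have /imsetP[y Gy defD] := subsetP sPG D PD.
by move: Dx; rewrite defD defC => /class_eqP->; rewrite -defD.
Qed.

Lemma cover_etaM (gT : finGroupType) (G : {group gT}) (a b : gT) :
  a \in G -> b \in G ->
  cover [set C in classes G | C \subset a ^: G * b ^: G] = a ^: G * b ^: G.
Proof.
move=> Ga Gb; apply/eqP; rewrite eqEsubset; apply/andP; split.
  by apply/bigcupsP=> C; rewrite inE => /andP[].
apply/subsetP=> x abx; apply/bigcupP; exists (x ^: G); last exact: class_refl.
have /mulsgP[u v /imsetP[s Gs ->] /imsetP[t Gt ->] defx] := abx.
have Gx : x \in G by rewrite defx groupM ?groupJ.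
rewrite inE mem_classes //=; apply/subsetP=> _ /imsetP[z Gz ->].
by rewrite defx conjMg -!conjgM mem_mulg // memJ_class ?groupM.
Qed.

(* Main.v *)
(* If A and B are not scalar, the products A' B' of conjugates of A and B take
   every value of F but at most one as traces, and the trace is a class
   invariant.
   For n >= 3, pick a row v that is not a left eigenvector of A and a nonzero
   column u killed by v and v A, and put N = u v.  Conjugating A by the
   transvections 1 + l N makes tr (A' B') an affine function of l, of slope
   tr ([N, A] B').  As [N, A] is not scalar, some conjugate B' of B gives a
   nonzero slope, provided q >= 3 (for q = 2 there is nothing to prove).
   For n = 2, if A - a is singular for some a in F then A - a = u v, and
   tr (A B') = a tr B + v B' u, where v B' u takes every nonzero value.  If
   neither A nor B has an eigenvalue in F, prescribing the trace amounts to
   finding a point on a conic, which exists by Chevalley's theorem. *)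
Require Import Defs.
From mathcomp Require Import ring.

Set Implicit Arguments.
Unset Strict Implicit.
Unset Printing Implicit Defensive.

Import GRing.Theory.
Local Open Scope ring_scope.

(** * Squares and conics over a finite field *)

(** The squares fill more than half of [F], and so does their image under the injection
    [z |-> k * z + m]; hence the two sets meet. *)
Lemma pigeonhole_sqr (F : finFieldType) (k m : F) :
  k != 0 -> exists x y, y ^+ 2 = k * x ^+ 2 + m.
Proof.
move=> k0; pose I := [set x ^+ 2 | x : F]; pose J := [set k * z + m | z in I].
have cardJ : #|J| = #|I|.
  by apply: card_imset => z1 z2 /addIr /(mulfI k0).
pose r y : F := odflt 0 [pick x | x ^+ 2 == y].
have rP x : r (x ^+ 2) ^+ 2 = x ^+ 2.
  by rewrite /r; case: pickP => [z /eqP|/(_ x)] //; rewrite eqxx.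
have sqrI x : x ^+ 2 \in I by apply: imset_f.
have I0 : 0 \in I by have := sqrI 0; rewrite expr0n.
(* Each [x] is plus or minus the chosen root of its square. Counting 0 only once makes the resulting
   bound strict. *)
have cover_F : [set: F] \subset r @: I :|: [set - r z | z in I :\ 0].
  apply/subsetP=> x _; rewrite inE.
  have /eqP := rP x; rewrite eq_sym eqf_sqr => /orP[/eqP xr|/eqP xr].
    by apply/orP; left; apply/imsetP; exists (x ^+ 2).
  have [x0|x0] := eqVneq x 0; apply/orP; [left | right]; apply/imsetP.
    by exists (x ^+ 2); rewrite // -[RHS]opprK -xr x0 oppr0.
  by exists (x ^+ 2); rewrite // in_setD1 sqrf_eq0 x0 sqrI.
have ltFI : (#|F| < #|I| + #|I|)%N.
  have := leq_trans (subset_leq_card cover_F) (leq_card_setU _ _).1.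
  rewrite cardsT => /leq_ltn_trans-> //.
  rewrite -addnS leq_add ?leq_imset_card // [in leqRHS](cardsD1 0) I0 ltnS.
  exact: leq_imset_card.
have [/eqP IJ0|[y]] := set_0Vmem (I :&: J).
  have := max_card (I :|: J).
  by rewrite cardsU (eqP IJ0) cards0 subn0 cardJ leqNgt ltFI.
by case/setIP=> /imsetP[y0 _ ->] /imsetP[_ /imsetP[x _ ->] e]; exists x, y0.
Qed.

(** The quadratics stand for the characteristic polynomials of [A] and [B]. If [A'] has rows
    [(0, 1)] and [(- d, t)], and [B'] has first row [(a, b)], trace [t'] and determinant [d'], the
    equation reads [b * \tr (A' *m B') = s * b]. *)
Lemma conic_point (F : finFieldType) (t d t' d' s : F) :
    (forall x, x ^+ 2 - t * x + d != 0) ->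
    (forall x, x ^+ 2 - t' * x + d' != 0) ->
  exists a b, b != 0 /\
    a * (t' - a) - d' - d * b ^+ 2 + t * (t' - a) * b = s * b.
Proof.
move=> irr irr'.
suff [a [b ab]] : exists a b,
    a * (t' - a) - d' - d * b ^+ 2 + t * (t' - a) * b = s * b.
  (* A point with [b = 0] would make [a] a root of the second polynomial. *)
exists a, b; split=> //; apply: contraNneq (irr' a) => b0.
  apply/eqP; move: ab; rewrite b0 => ab; rewrite -[RHS]oppr0 -(mulr0 s) -ab.
  by ring.
have [two0|two_neq0] := eqVneq (2%:R : F) 0.
  (* Since [-1 = 1], every [y ^+ 2 - x ^+ 2] is the square of [x + y]. *)
  have sqrt_ex (m : F) : exists y, y ^+ 2 = m.
    have [x [y xy]] := pigeonhole_sqr m (oner_neq0 F).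
    exists (x + y); rewrite sqrrD xy -mulr_natr two0 mulr0 addr0 mul1r addrA.
    by rewrite -mulr2n -mulr_natr two0 mulr0 add0r.
  have t0 : t != 0.
    apply/eqP=> t0; have [y yd] := sqrt_ex (- d).
    by have := irr y; rewrite yd t0 mul0r subr0 addNr eqxx.
  (* The choice [b = t' / t] cancels the term linear in [a]. *)
  have [a ad] := sqrt_ex
    (- (d' + d * (t' / t) ^+ 2 + (s - t * t') * (t' / t))).
  exists a, (t' / t); apply/eqP; rewrite -subr_eq0; apply/eqP.
  transitivity (- a ^+ 2
     - (d' + d * (t' / t) ^+ 2 + (s - t * t') * (t' / t))); first by field.
  rewrite ad.
  by ring.
(* This is a quarter of the discriminant; if it vanished, [t / 2] would be a root. *)
have k0 : t ^+ 2 / 4%:R - d != 0.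
  apply: contraNneq (irr (t / 2%:R)) => k0; apply/eqP.
  transitivity (- (t ^+ 2 / 4%:R - d)); last by rewrite k0 oppr0.
  by field; rewrite two_neq0 -[4%N]/(2 * 2)%N natrM mulf_neq0.
(* Complete the square in [a], then in [b]: [k] is the coefficient of [b ^+ 2]
   left by the first step, [l] that of [b]. *)
set k := _ - d in k0.
pose l := - (t * t' / 2%:R) - (s - t * t').
pose m := t' ^+ 2 / 4%:R - d' - l ^+ 2 / (4%:R * k).
have [x [y xy]] := pigeonhole_sqr m k0.
pose b := x - l / (2%:R * k).
exists (y - (t * b - t') / 2%:R), b.
have four0 : 4%:R != 0 :> F by rewrite -[4%N]/(2 * 2)%N natrM mulf_neq0.
apply/eqP; rewrite -subr_eq0; apply/eqP.
transitivity (- (y ^+ 2 - (k * x ^+ 2 + m))); last by rewrite xy subrr oppr0.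
rewrite /m /b /l.
have -> : d = t ^+ 2 / 4%:R - k by rewrite /k; ring.
by field; rewrite four0 two_neq0 k0.
Qed.

(** * Similarity with prescribed rows and entries *)

(** A nonzero off-diagonal entry is picked out by basis vectors. If [M] is diagonal, [e_0 + e_i] and
    [e_0 - e_i] give [M 0 0 - M i i]. *)
Lemma nonscalar_pair (F : fieldType) n (M : 'M[F]_n.+1) :
    ~~ is_scalar_mx M ->
  exists (v : 'rV_n.+1) (u : 'cV_n.+1), v *m u = 0 /\ v *m M *m u != 0.
Proof.
move=> nsM.
have sandwich i j : delta_mx 0 i *m M *m delta_mx j 0 = (M i j)%:M :> 'M_1.
  by rewrite -rowE -colE [LHS]mx11_scalar !mxE.
have pair (i j : 'I_n.+1) :
    delta_mx 0 i *m delta_mx j 0 = (i == j)%:R%:M :> 'M[F]_1.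
  have [->|ij] := eqVneq i j; last by rewrite mul_delta_mx_0 // raddf0.
  by rewrite mul_delta_mx [LHS]mx11_scalar mxE !eqxx.
have [/existsP[i /existsP[j /andP[ij Mij]]]|offdiag0] :=
    boolP [exists i, exists j, (i != j) && (M i j != 0)].
  exists (delta_mx 0 i), (delta_mx j 0).
  by rewrite pair sandwich (negPf ij) raddf0 fmorph_eq0.
have {offdiag0} M0 i j : i != j -> M i j = 0.
  move=> ij; apply/eqP; apply: contraNT offdiag0 => Mij.
  by apply/existsP; exists i; apply/existsP; exists j; rewrite ij.
have [/existsP[i Mi]|diag_const] := boolP [exists i, M i i != M 0 0].
  have i0 : i != 0 by apply: contraNneq Mi => ->.
  exists (delta_mx 0 0 + delta_mx 0 i), (delta_mx 0 0 - delta_mx i 0).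
  rewrite !(mulmxDl, mulmxBr) !pair !sandwich !eqxx (eq_sym 0 i).
  rewrite (negPf i0) (M0 i 0) // (M0 0 i) 1?eq_sym // !raddf0 !addr0 !add0r.
  rewrite subrr; split=> //; apply: contraNneq Mi => /matrixP/(_ 0 0).
  by rewrite !mxE eqxx !mulr1n => /esym/subr0_eq->.
case/is_scalar_mxP: nsM; exists (M 0 0); apply/matrixP=> i j; rewrite mxE.
have [<-|/M0 //] := eqVneq i j.
by apply/eqP; apply: contraNT diag_const => Mi; apply/existsP; exists i.
Qed.

Definition simmx (F : fieldType) n (A B : 'M[F]_n.+1) :=
  exists2 P, P \in unitmx & B = P *m A *m invmx P.

Lemma simmx_refl (F : fieldType) n (A : 'M[F]_n.+1) : simmx A A.
Proof. by exists 1%:M; rewrite ?unitmx1 // invmx1 mul1mx mulmx1. Qed.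

Lemma simmx_trans (F : fieldType) n (A B C : 'M[F]_n.+1) :
  simmx A B -> simmx B C -> simmx A C.
Proof.
move=> [P uP ->] [Q uQ ->]; exists (Q *m P); first by rewrite unitmx_mul uQ.
have -> : invmx (Q *m P) = invmx P *m invmx Q by apply: invrM.
by rewrite !mulmxA.
Qed.

Lemma simmx_trace (F : fieldType) n (A B : 'M[F]_n.+1) :
  simmx A B -> \tr B = \tr A.
Proof. by case=> P uP ->; rewrite mxtrace_mulC mulKmx. Qed.

Lemma simmx_det (F : fieldType) n (A B : 'M[F]_n.+1) :
  simmx A B -> \det B = \det A.
Proof.
case=> P uP ->; rewrite !det_mulmx mulrAC -det_mulmx mulmxV //.
by rewrite det1 mul1r.
Qed.

(** Some row [x] is independent of [x B]; an invertible [P] with [v P = x] and [z P = x B] gives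
    [v P B P^-1 = z]. *)
Lemma simmx_row (F : fieldType) n (B : 'M[F]_n.+1) (v z : 'rV_n.+1) :
    ~~ is_scalar_mx B -> v != 0 -> ~~ (z <= v)%MS ->
  exists2 B', simmx B B' & v *m B' = z.
Proof.
move=> /nonscalar_pair[x [u [xu xBu]]] v0 zv.
have rank2 (y w : 'rV[F]_n.+1) :
    y != 0 -> ~~ (w <= y)%MS -> row_free (col_mx y w).
  move=> y0 wy; rewrite -row_leq_rank -addsmxE.
  have : (y < y + w)%MS by rewrite ltmxE addsmxSl addsmx_sub submx_refl.
  by move/rank_ltmx; rewrite rank_rV y0.
have x0 : x != 0 by apply: contraNneq xBu => ->; rewrite !mul0mx.
have xBx : ~~ (x *m B <= x)%MS.
  by apply: contra xBu => /submxP[D ->]; rewrite -mulmxA xu mulmx0.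
pose f := pinvmx (col_mx v z) *m col_mx x (x *m B).
have vzf : col_mx v z *m f = col_mx x (x *m B).
  by rewrite mulmxA mulmxVp ?mul1mx ?rank2.
have /complete_unitmx[P uP] : \rank (col_mx v z *m f) = \rank (col_mx v z).
  by rewrite vzf (eqP (rank2 _ _ x0 xBx)) (eqP (rank2 _ _ v0 zv)).
rewrite vzf mul_col_mx => /eq_col_mx[xP xBP].
exists (P *m B *m invmx P); first by exists P.
by rewrite !mulmxA -xP xBP -mulmxA mulmxV // mulmx1.
Qed.

Lemma ker_cV2 (F : fieldType) n (v w : 'rV[F]_n.+3) :
  exists2 u : 'cV_n.+3, u != 0 & v *m u = 0 /\ w *m u = 0.
Proof.
have : kermx (col_mx v w)^T != 0.
  rewrite kermx_eq0 -row_leq_rank -ltnNge.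
  exact: leq_ltn_trans (rank_leq_col _) _.
case/rowV0Pn=> u /sub_kermxP uvw u0; exists u^T; first by rewrite trmx_eq0.
move/(congr1 trmx): uvw; rewrite trmx_mul trmxK mul_col_mx trmx0 -col_mx0.
exact: eq_col_mx.
Qed.

Lemma simmx_entry (F : fieldType) n (B : 'M[F]_n.+2)
    (v : 'rV_n.+2) (u : 'cV_n.+2) c :
    ~~ is_scalar_mx B -> v != 0 -> u != 0 -> c != 0 ->
  exists2 B', simmx B B' & v *m B' *m u = c%:M.
Proof.
move=> nsB v0 u0 c0.
suff [z zu zv] : exists2 z : 'rV_n.+2, z *m u = c%:M & ~~ (z <= v)%MS.
  by have [B' BB' vB'] := simmx_row nsB v0 zv; exists B'; rewrite ?vB'.
have [z0 z0u] : exists z0 : 'rV_n.+2, z0 *m u = c%:M.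
  have [i ui] : exists i, u i 0 != 0.
    by case/cV0Pn: u0 => i ui; exists i.
  exists ((c / u i 0) *: delta_mx 0 i); rewrite -scalemxAl -rowE.
  by apply/matrixP=> j k; rewrite !ord1 !mxE divfK.
have [z0v|] := boolP (z0 <= v)%MS; last by exists z0.
have : kermx u != 0.
  by rewrite kermx_eq0 -row_leq_rank -ltnNge (leq_ltn_trans (rank_leq_col _)).
case/rowV0Pn=> k /sub_kermxP ku k0.
(* If [z0 + k] were still on the line of [v], then [z0] would be a multiple of [k], so [z0 u = 0],
   against [c != 0]. *)
exists (z0 + k); first by rewrite mulmxDl ku addr0.
apply/negP=> z0kv.
have kv : (k <= v)%MS by rewrite -[k](addKr z0) addmx_sub ?eqmx_opp.
have vk : (v <= k)%MS.
  by rewrite -(geq_leqif (mxrank_leqif_sup kv)) !rank_rV v0 k0.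
have /submxP[D z0D] := submx_trans z0v vk.
move/matrixP/(_ 0 0): z0u.
rewrite z0D -mulmxA ku mulmx0 !mxE eqxx mulr1n => c0'.
by rewrite -c0' eqxx in c0.
Qed.

(** * Transvections, and traces in size at least 3 *)

Lemma mxtrace_rank1 (F : fieldType) n (C : 'M[F]_n)
    (v : 'rV_n) (u : 'cV_n) : \tr (u *m v *m C) = (v *m C *m u) 0 0.
Proof. by rewrite -mulmxA mxtrace_mulC trace_mx11. Qed.

(** As [N ^ 2 = 0], the inverse of [1 + l N] is [1 - l N]; the quadratic term comes from
    [N A N = (v A u) N]. *)
Lemma simmx_transvection (F : fieldType) n (A B : 'M[F]_n.+1)
    (v : 'rV_n.+1) (u : 'cV_n.+1) l (N := u *m v) : v *m u = 0 ->
  exists2 A', simmx A A' &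
    \tr (A' *m B) = \tr (A *m B) + l * \tr ((N *m A - A *m N) *m B)
                   - l ^+ 2 * ((v *m A *m u) 0 0 * (v *m B *m u) 0 0).
Proof.
move=> vu.
have NN : N *m N = 0 by rewrite mulmxA -(mulmxA u) vu mulmx0 mul0mx.
have TV : (1%:M + l *: N) *m (1%:M - l *: N) = 1%:M.
  rewrite mulmxDl !mulmxBr !mulmx1 !mul1mx -scalemxAl -scalemxAr NN !scaler0.
  by rewrite subr0 subrK.
have [uT _] := mulmx1_unit TV.
exists ((1%:M + l *: N) *m A *m invmx (1%:M + l *: N)).
  by exists (1%:M + l *: N).
have -> : invmx (1%:M + l *: N) = 1%:M - l *: N.
  by rewrite -[RHS](mulKmx uT) TV mulmx1.
rewrite -(mxtrace_rank1 B).
have -> : (v *m A *m u) 0 0 * \tr (u *m v *m B) = \tr (N *m A *m N *m B).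
  rewrite -mxtraceZ /N !mulmxA -(mulmxA u v A) -(mulmxA u _ u).
  by rewrite [in RHS](mx11_scalar (v *m A *m u)) mul_mx_scalar -!scalemxAl.
rewrite -!mxtraceZ -!raddfD -raddfB; congr (\tr _).
clearbody N.
rewrite !(mulmxDl, mulmxBr, mulmxBl, mul1mx, mulmx1, scalerBr).
rewrite -!(scalemxAl, scalemxAr) !mulNmx -!scalemxAl scalerBr scalerA -expr2.
by rewrite addrA -(addrA (A *m B)) (addrC (- _)).
Qed.

(** If all these traces vanished, a polynomial of degree 2 would have the three roots 0, 1 and
    [l]. *)
Lemma simmx_trace_neq0 (F : finFieldType) n (l : F) (M B : 'M[F]_n.+2) :
    l != 0 -> l != 1 -> ~~ is_scalar_mx M -> ~~ is_scalar_mx B ->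
  exists2 B', simmx B B' & \tr (B' *m M) != 0.
Proof.
move=> l0 l1 nsM nsB.
have [/existsP[P /andP[uP trP]]|tr_eq0] :=
    boolP [exists P, (P \in unitmx) && (\tr (P *m B *m invmx P *m M) != 0)].
  by exists (P *m B *m invmx P) => //; exists P.
have tr0 B' : simmx B B' -> \tr (B' *m M) = 0.
  case=> P uP ->; apply/eqP; apply: contraNT tr_eq0 => trP.
  by apply/existsP; exists P; rewrite uP.
have [v [u [vu vMu]]] := nonscalar_pair nsM.
have v0 : v != 0 by apply: contraNneq vMu => ->; rewrite !mul0mx.
have u0 : u != 0 by apply: contraNneq vMu => ->; rewrite !mulmx0.
have [B0 BB0 vB0u] := simmx_entry nsB v0 u0 (oner_neq0 F).
pose k := \tr ((u *m v *m B0 - B0 *m (u *m v)) *m M).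
pose c := (v *m M *m u) 0 0.
(* Conjugation by [1 + a *: N] gives this trace; it vanishes for
   [a = 1] and [a = l] only if [c = 0]. *)
have quad a : a * k - a ^+ 2 * c = 0.
  have [B1 B01] := simmx_transvection B0 M a vu.
  rewrite (tr0 B1 (simmx_trans BB0 B01)) (tr0 B0 BB0) vB0u mxE eqxx mul1r.
  by rewrite add0r.
have c0 : c != 0.
  by apply: contraNneq vMu => c0; rewrite [_ *m u]mx11_scalar -/c c0 raddf0.
have kc : k = c by apply: subr0_eq; have := quad 1; rewrite expr1n !mul1r.
have /eqP := quad l; rewrite kc expr2 -mulrA -mulrBr mulf_eq0 (negPf l0) /=.
rewrite -{1}[c]mul1r -mulrBl mulf_eq0 (negPf c0) orbF subr_eq0.
by rewrite eq_sym (negPf l1).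
Qed.

Lemma simmx_trace_ge3 (F : finFieldType) n (A B : 'M[F]_n.+3) :
    ~~ is_scalar_mx A -> ~~ is_scalar_mx B ->
  exists s0, forall s, s != s0 -> exists A' B',
    [/\ simmx A A', simmx B B' & \tr (A' *m B') = s].
Proof.
move=> nsA nsB.
have [l /andP[l0 l1]|F01] := pickP [pred l : F | (l != 0) && (l != 1)];
  last first.
  (* Here [F] has two elements, and the only value left is [\tr (A *m B)]. *)
  exists (1 + \tr (A *m B)) => s s0; exists A, B; split; try exact: simmx_refl.
  have := F01 (s - \tr (A *m B)); rewrite /= subr_eq0 subr_eq s0 andbT.
  by move/negbFE/eqP.
exists 0 => s _.
have [v [u0 [vu0 vAu0]]] := nonscalar_pair nsA.
have [u u_neq0 [vu vAu]] := ker_cV2 v (v *m A).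
pose M := u *m v *m A - A *m (u *m v).
(* [M] kills [u], so as a scalar it would be 0; but [M u0 = (v A u0) u] is nonzero. *)
have nsM : ~~ is_scalar_mx M.
  apply/negP=> /is_scalar_mxP[c Mc].
  have c0 : c = 0.
    have : M *m u = 0.
      by rewrite mulmxBl -!mulmxA vu (mulmxA v) vAu !mulmx0 subr0.
    move/eqP; rewrite Mc mul_scalar_mx scaler_eq0 (negPf u_neq0) orbF.
    by move/eqP.
  have : M *m u0 = 0 by rewrite Mc c0 mul_scalar_mx scale0r.
  rewrite mulmxBl -!mulmxA vu0 (mulmxA v) !mulmx0 subr0.
  rewrite (mx11_scalar (v *m A *m u0)) mul_mx_scalar => /eqP.
  rewrite scaler_eq0 (negPf u_neq0) orbF => /eqP e.
  by case/eqP: vAu0; rewrite [LHS]mx11_scalar e raddf0.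
have [B' BB' slope] := simmx_trace_neq0 l0 l1 nsM nsB.
have [A' AA' trA'] :=
  simmx_transvection A B' ((s - \tr (A *m B')) / \tr (B' *m M)) vu.
exists A', B'; split=> //.
rewrite trA' vAu mxE mul0r mulr0 subr0 -/M [\tr (M *m _)]mxtrace_mulC divfK //.
by rewrite addrC subrK.
Qed.

(** * Traces in size 2 *)

Lemma sum_ord2 (V : nmodType) (f : 'I_2 -> V) : \sum_i f i = f 0 + f 1.
Proof.
rewrite 2!big_ord_recl big_ord0 addr0; congr (_ + f _); exact/val_inj.
Qed.

Lemma mxtrace2 (F : fieldType) (A : 'M[F]_2) : \tr A = A 0 0 + A 1 1.
Proof. exact: sum_ord2. Qed.

Lemma det2 (F : fieldType) (A : 'M[F]_2) :
  \det A = A 0 0 * A 1 1 - A 0 1 * A 1 0.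
Proof.
rewrite (expand_det_row _ 0) 2!big_ord_recl big_ord0 addr0 /cofactor !det_mx11.
rewrite !mxE /= expr0 mul1r expr1 mulN1r mulrN.
by congr (_ * A _ _ - A _ _ * A _ _); apply/val_inj.
Qed.

(** [simmx_row] prescribes the first row; the trace and the determinant then fix the second. *)
Lemma simmx_row2 (F : fieldType) (A : 'M[F]_2) a b :
    ~~ is_scalar_mx A -> b != 0 ->
  exists2 A', simmx A A' & [/\ A' 0 0 = a, A' 0 1 = b,
    A' 1 1 = \tr A - a & b * A' 1 0 = a * (\tr A - a) - \det A].
Proof.
move=> nsA b0; pose z : 'rV[F]_2 := \row_j (if j == 0 then a else b).
have v0 : delta_mx 0 0 != 0 :> 'rV[F]_2.
  by apply/eqP=> /matrixP/(_ 0 0)/eqP; rewrite !mxE !eqxx oner_eq0.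
have zv : ~~ (z <= (delta_mx 0 0 : 'rV_2))%MS.
  apply/negP=> /submxP[D /matrixP/(_ 0 1)/eqP].
  by rewrite mxE (mx11_scalar D) mul_scalar_mx !mxE /= mulr0 (negPf b0).
have [A' AA' rA'] := simmx_row nsA v0 zv; exists A' => //.
rewrite -rowE in rA'.
have A00 : A' 0 0 = a by have /matrixP/(_ 0 0) := rA'; rewrite !mxE.
have A01 : A' 0 1 = b by have /matrixP/(_ 0 1) := rA'; rewrite !mxE.
have A11 : A' 1 1 = \tr A - a.
  by rewrite -(simmx_trace AA') mxtrace2 A00 addrC addKr.
split=> //; rewrite -(simmx_det AA') det2 A00 A01 A11.
by rewrite opprB addrCA subrr addr0.
Qed.

Lemma simmx_trace_root (F : fieldType) (A B : 'M[F]_2) a :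
    ~~ is_scalar_mx A -> ~~ is_scalar_mx B ->
    a ^+ 2 - \tr A * a + \det A = 0 ->
  exists s0, forall s, s != s0 -> exists A' B',
    [/\ simmx A A', simmx B B' & \tr (A' *m B') = s].
Proof.
move=> nsA nsB ra.
have [A' AA' [A00 A01 A11 A10]] := simmx_row2 0 nsA (oner_neq0 F).
rewrite subr0 in A11; rewrite mul1r mul0r sub0r in A10.
(* Since [a] is an eigenvalue, [A' - a] has rank one: its first row is [v], and its second is
   [\tr A - a] times [v]. *)
pose u : 'cV[F]_2 := \col_i (if i == 0 then 1 else \tr A - a).
pose v : 'rV[F]_2 := \row_j (if j == 0 then - a else 1).
have defA' : A' = a%:M + u *m v.
  have ord2 (i : 'I_2) : i = 0 \/ i = 1.
    by case: i => [[|[|i]] lti] //; [left | right]; apply/val_inj.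
  apply/matrixP=> i j; rewrite !mxE big_ord1 !mxE.
  case: (ord2 i) => ->; case: (ord2 j) => -> /=.
  - by rewrite A00 mul1r subrr.
  - by rewrite A01 mul1r add0r.
  - rewrite A10 add0r; apply/eqP; rewrite -subr_eq0 -oppr_eq0 -ra.
    by apply/eqP; ring.
  - by rewrite A11; ring.
have u0 : u != 0.
  by apply/eqP=> /matrixP/(_ 0 0)/eqP; rewrite !mxE oner_eq0.
have v0 : v != 0.
  by apply/eqP=> /matrixP/(_ 0 1)/eqP; rewrite !mxE oner_eq0.
exists (a * \tr B) => s; rewrite -subr_eq0 => s0.
have [B' BB' vB'u] := simmx_entry nsB v0 u0 s0; exists A', B'; split=> //.
rewrite defA' mulmxDl raddfD /= mul_scalar_mx mxtraceZ mxtrace_rank1 vB'u.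
by rewrite (simmx_trace BB') mxE eqxx mulr1n addrC subrK.
Qed.

Lemma simmx_trace2 (F : finFieldType) (A B : 'M[F]_2) :
    ~~ is_scalar_mx A -> ~~ is_scalar_mx B ->
  exists s0, forall s, s != s0 -> exists A' B',
    [/\ simmx A A', simmx B B' & \tr (A' *m B') = s].
Proof.
move=> nsA nsB.
have [a /eqP rA|irrA] := pickP [pred a | a ^+ 2 - \tr A * a + \det A == 0].
  exact: simmx_trace_root rA.
have [b /eqP rB|irrB] := pickP [pred b | b ^+ 2 - \tr B * b + \det B == 0].
  have [s0 s0P] := simmx_trace_root nsB nsA rB.
  exists s0 => s /s0P[B' [A' [BB' AA' <-]]]; exists A', B'.
  by rewrite mxtrace_mulC.
exists 0 => s _.
have [a [b [b0 ab]]] :=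
  conic_point s (fun x => negbT (irrA x)) (fun x => negbT (irrB x)).
have [A' AA' [A00 A01 A11 A10]] := simmx_row2 0 nsA (oner_neq0 F).
rewrite subr0 in A11; rewrite mul1r mul0r sub0r in A10.
have [B' BB' [B00 B01 B11 B10]] := simmx_row2 a nsB b0.
(* [B' 1 0] is known only through [b * B' 1 0], hence the factor [b]. *)
exists A', B'; split=> //; apply: (mulfI b0).
rewrite mxtrace2 !mxE !sum_ord2.
rewrite A00 A01 A10 A11 B01 B11 mul0r add0r mul1r mulrDr B10 [b * s]mulrC -ab.
by ring.
Qed.

(** * From traces to conjugacy classes *)

Local Open Scope group_scope.

Lemma scalar_GL_cent (n : nat) (F : finFieldType) (A : {'GL_n[F]}) :
  is_scalar_mx (GLval A) -> A \in 'C('GL_n[F]).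
Proof.
case/is_scalar_mxP=> c Ac; apply/centP=> B _; apply: (@val_inj _ _ {'GL_n[F]}).
change (GLval (A * B) = GLval (B * A)).
by rewrite !GL_MxE Ac scalar_mxC.
Qed.

Lemma class_mul_cent (gT : finGroupType) (G : {group gT}) (a b : gT) :
  a \in 'C(G) -> a ^: G * b ^: G = (a * b) ^: G.
Proof.
move=> cGa; have conj_a g : g \in G -> a ^ g = a.
  by move=> Gg; rewrite conjgE (centP cGa g Gg) mulKg.
rewrite (cent_classP _ _ cGa); apply/setP=> x; rewrite mem_lcoset.
apply/imsetP/imsetP=> -[g Gg xg]; exists g => //.
  by rewrite conjMg conj_a // -xg mulKVg.
by rewrite xg conjMg conj_a // mulKg.
Qed.

Lemma simmx_class (n : nat) (F : finFieldType) (A : {'GL_n[F]}) A' :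
  simmx (GLval A) A' -> exists2 C, C \in A ^: 'GL_n[F] & GLval C = A'.
Proof.
case=> P uP ->; pose g : {'GL_n[F]} := FinRing.unit _ uP.
exists (A ^ g^-1); first by rewrite memJ_class ?inE.
by rewrite conjgE invgK !GL_MxE GL_VxE mulmxA.
Qed.

(* As 1 < n, the matrices of {'GL_n[F]}, of size n.-1.+1, have size n. *)
Theorem theoremA (p m n : nat) (F : finFieldType)
    (p_prime : prime p) (m_gt0 : (0 < m)%N) (n_ge2 : (2 <= n)%N)
    (cardF : #|F| = (p ^ m)%N) (A B : {'GL_n[F]}) :
  (A ^: 'GL_n[F] * B ^: 'GL_n[F] = (A * B) ^: 'GL_n[F]
     /\ (is_scalar_mx (GLval A) \/ is_scalar_mx (GLval B)))
  \/ (p ^ m - 1 <= eta 'GL_n[F] (A ^: 'GL_n[F] * B ^: 'GL_n[F]))%N.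
Proof.
have GLT (C : {'GL_n[F]}) : C \in 'GL_n[F] by rewrite inE.
have [sA|nsA] := boolP (is_scalar_mx (GLval A)).
  by left; split; [apply/class_mul_cent/scalar_GL_cent | left].
have [sB|nsB] := boolP (is_scalar_mx (GLval B)).
  have cB := scalar_GL_cent sB.
  left; split; last by right.
  have -> : A ^: 'GL_n[F] * B ^: 'GL_n[F] = B ^: 'GL_n[F] * A ^: 'GL_n[F].
    (* The whole group normalises a class, so the two classes commute as sets. *)
    by apply/normC/(subset_trans _ (class_norm _ _))/subsetP.
  by rewrite class_mul_cent // (centP cB _ (GLT A)).
right.
have [s0 s0P] : exists s0 : F, forall s, s != s0 -> exists A' B',
    [/\ simmx (GLval A) A', simmx (GLval B) B' & (\tr (A' *m B') = s)%R].
  case: n n_ge2 A B nsA nsB {GLT} => [|[|[|n]]] // _ A B nsA nsB.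
    exact: simmx_trace2.
  exact: simmx_trace_ge3.
rewrite -cardF subn1 -(cardsC1 s0) /eta; set S := [set C in _ | _].
(* The trace of a representative maps [S] onto a set containing all of [F] but [s0]. *)
pose trC (C : {set {'GL_n[F]}}) : F := \tr (GLval (repr C)).
apply: leq_trans (leq_imset_card trC S); apply/subset_leq_card/subsetP=> s.
rewrite !inE => /s0P[A' [B' []]].
move=> /simmx_class[X AX <-] /simmx_class[Y BY <-] trXY.
have := mem_mulg AX BY.
rewrite -(cover_etaM (GLT A) (GLT B)) => /bigcupP[C SC XYC].
apply/imsetP; exists C => //; rewrite -trXY /trC.
have /imsetP[Z _ defC] : C \in classes 'GL_n[F].
  by move: SC; rewrite inE => /andP[].
move: XYC; rewrite defC => /class_eqP<-.
have [g _ ->] := repr_class 'GL_n[F] (X * Y).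
by rewrite conjgE -GL_MxE [in RHS]GL_MxE [RHS]mxtrace_mulC -GL_MxE mulgK.
Qed.
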